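(* Let $\epsilon\in(0,1)$, let $\mathbf{X},\lambda,\mathbf{\Omega},\mu,\mathbf{K},\mathbf{K}_{\mathbf{x}}$ be as in the context, and assume that $\mathbf{K}$ and $(\mathbf{X}\times\mathbf{\Omega})\setminus\mathbf{K}$ have nonempty interior. Let $$\mathbf{X}^*_\epsilon:=\{\mathbf{x}\in\mathbf{X}:\mu(\mathbf{K}_{\mathbf{x}})\ge1-\epsilon\}.$$ For each $d$ let $p_d^*$ be an optimal solution of the program $(\mathrm{D}_d)$ defined in the context, let $h_d^*\in\mathbb{R}[\mathbf{x}]_{2d}$ be the polynomial $h_d^*(\mathbf{x})=\int_{\mathbf{\Omega}}p_d^*(\mathbf{x},\omega)\,\mu(d\omega)$, and let $$\mathbf{X}^d_\epsilon:=\{\mathbf{x}\in\mathbf{X}:h_d^*(\mathbf{x})\ge1-\epsilon\}.$$ Then $$\lim_{d\to\infty}\lambda(\mathbf{X}^d_\epsilon)=\lambda(\mathbf{X}^*_\epsilon).$$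
   Context: Setting. $\mathbf{X}\subset\mathbb{R}^n$ is a compact box, $\lambda$ is the Lebesgue measure on $\mathbf{X}$, and $\mu$ is a Borel probability measure on $\mathbb{R}^p$ with compact support $\mathbf{\Omega}\subset\mathbb{R}^p$. $\mathbf{K}=\{(\mathbf{x},\omega): g_j(\mathbf{x},\omega)\ge0,\ j=1,\ldots,m\}\subset\mathbf{X}\times\mathbf{\Omega}$ is compact, with $g_1,\ldots,g_m\in\mathbb{R}[\mathbf{x},\omega]$, where (with no loss of generality) $g_1(\mathbf{x},\omega)=M-\|(\mathbf{x},\omega)\|^2$ for some $M>0$. For $\mathbf{x}\in\mathbf{X}$, $\mathbf{K}_{\mathbf{x}}=\{\omega\in\mathbf{\Omega}:(\mathbf{x},\omega)\in\mathbf{K}\}$ (possibly empty). The product measure on $\mathbf{X}\times\mathbf{\Omega}$ is $\lambda\otimes\mu$. $\mathbb{R}[\cdot]_k$ denotes polynomials of degree at most $k$, and SOS means sum of squares of polynomials. The index $d$ ranges over integers $d\ge\max_j\lceil\deg(g_j)/2\rceil$. Program $(\mathrm{D}_d)$ (under the stated nonempty-interior assumptions it has an optimal solution): $$\inf_{p\in\mathbb{R}[\mathbf{x},\omega]_{2d}}\ \int_{\mathbf{X}\times\mathbf{\Omega}}p(\mathbf{x},\omega)\,(\lambda\otimes\mu)(d(\mathbf{x},\omega))\quad\text{s.t. } p(\mathbf{x},\omega)\ge1\ \ \forall(\mathbf{x},\omega)\in\mathbf{K},\quad p \text{ is SOS}.$$ *)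

(* Defs.v *)
From HB Require Import structures.
From mathcomp Require Import all_boot all_order all_algebra.
(* mpoly goes first and without its notations, which clash with those of
   mathcomp-analysis (as does its isMeasure). *)
From mathcomp Require Import -(notations) mpoly.
From mathcomp Require Import all_classical all_reals all_analysis.

Set Implicit Arguments.
Unset Strict Implicit.
Unset Printing Implicit Defensive.

Import Order.TTheory GRing.Theory Num.Theory.
Import numFieldNormedType.Exports.

Local Open Scope classical_set_scope.
Local Open Scope ring_scope.

(* R^n is 'rV[R]_n with its Borel sigma-algebra, generated by the open sets. *)
HB.instance Definition _ (R : realType) (n : nat) :=
  Measurable.copy 'rV[R]_n (g_sigma_algebraType (@open 'rV[R]_n)).

Section measurable_rV.
Context {R : realType}.

Lemma measurable_fun_rV d (T : measurableType d) n (f : T -> 'rV[R]_n) :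
  (forall i, measurable_fun setT (fun t => f t ord0 i)) ->
  measurable_fun setT f.
Proof.
move=> mf.
have mbox (q : 'rV[rat]_n * 'rV[rat]_n) : measurable (f @^-1`
    [set v | forall i, ratr (q.1 ord0 i) < v ord0 i < ratr (q.2 ord0 i)]).
  rewrite (_ : _ @^-1` _ = \bigcap_(i in [set: 'I_n])
      ((fun t => f t ord0 i) @^-1`
         `]ratr (q.1 ord0 i), ratr (q.2 ord0 i)[)); last first.
    by apply/seteqP; split => [t H i _|t H i];
      [rewrite /= in_itv /=; exact: H|have := H i I; rewrite /= in_itv].
  apply: fin_bigcap_measurable => // i _.
  by rewrite -[X in measurable X]setTI; apply: mf.
apply: measurability => //.
move=> _ [U oU <-]; rewrite setTI.
pose B (q : 'rV[rat]_n * 'rV[rat]_n) :=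
  [set v : 'rV[R]_n |
    forall i, ratr (q.1 ord0 i) < v ord0 i < ratr (q.2 ord0 i)].
rewrite (_ : U = \bigcup_q (B q `&` [set _ | B q `<=` U])); last first.
  apply/seteqP; split => [v Uv|v [q _ [Bqv BqU]]]; last exact: BqU.
  have /nbhs_ballP[e /= e0 eU] : nbhs v U by exact: open_nbhs_nbhs.
  have /choice[q1 q1P] (i : 'I_n) :
      exists q : rat, ratr q \in `](v ord0 i - e), (v ord0 i)[.
    by apply/rat_in_itvoo; rewrite ltrBlDr ltrDl.
  have /choice[q2 q2P] (i : 'I_n) :
      exists q : rat, ratr q \in `](v ord0 i), (v ord0 i + e)[.
    by apply/rat_in_itvoo; rewrite ltrDl.
  exists (\row_i q1 i, \row_i q2 i) => //; split=> /= [i|w Bw].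
    rewrite !mxE; move: (q1P i) (q2P i).
    by rewrite !in_itv /= => /andP[_ ->] /andP[-> _].
  apply: eU; split=> // i j; rewrite ord1 /ball /=.
  move: (Bw j) (q1P j) (q2P j); rewrite !mxE !in_itv /=.
  move=> /andP[w1 w2] /andP[h1 _] /andP[_ h2].
  rewrite ltr_distlC; apply/andP; split; first exact: lt_trans w1.
  exact: lt_trans h2.
rewrite preimage_bigcup; apply: countable_bigcupT_measurable => // q.
have [BU|BU] := pselect (B q `<=` U).
- rewrite (_ : _ `&` _ = B q); first exact: mbox.
  by apply/seteqP; split => [v []|].
- rewrite (_ : _ `&` _ = set0) ?preimage_set0//.
  by apply/seteqP; split => [v []|].
Qed.

Lemma measurable_coord_rV n (i : 'I_n) :
  measurable_fun setT (fun v : 'rV[R]_n => v ord0 i).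
Proof.
apply: (measurability _ (measurable_realfun.RGenOpens.measurableE R)).
move=> _ [_ [a [b ->] <-]]; rewrite setTI; apply: sub_sigma_algebra.
apply: open_comp => [v _|]; first exact: coord_continuous.
exact: interval_open.
Qed.

End measurable_rV.

Section lebesgue_rV.
Context {R : realType}.

Definition cons_rV n (z : 'rV[R]_n * measurableTypeR R) : 'rV[R]_n.+1 :=
  row_mx (z.2)%:M z.1 : 'rV[R]_(1 + n).

(* Lebesgue measure on R^n: the n-fold product of the one on R. *)
Fixpoint lebesgue_rV n : set 'rV[R]_n -> \bar R :=
  match n with
  | 0 => \d_(0 : 'rV[R]_0)
  | n'.+1 =>
    pushforward (lebesgue_rV (n := n') \x lebesgue_measure)%E (@cons_rV n')
  end.

Lemma measurable_cons_rV n : measurable_fun setT (@cons_rV n).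
Proof.
apply: measurable_fun_rV => i; case: (@split_ordP 1 n i) => j -> /=.
  rewrite (_ : (fun=> _) = snd); first exact: measurable_snd.
  by apply/funext => z; rewrite /cons_rV (row_mxEl (z.2)%:M) !ord1 mxE eqxx.
rewrite (_ : (fun=> _) = (fun v : 'rV[R]_n => v ord0 j) \o fst); last first.
  by apply/funext => z /=; rewrite /cons_rV (row_mxEr (z.2)%:M).
exact: measurableT_comp (measurable_coord_rV j) measurable_fst.
Qed.

Lemma lebesgue_rV_measure n :
  {m : {measure set 'rV[R]_n -> \bar R} | m = @lebesgue_rV n :> (set _ -> _)}.
Proof.
elim: n => [|n [m mE]]; first by exists \d_(0 : 'rV[R]_0).
pose m' : {measure set ('rV[R]_n * measurableTypeR R) -> \bar R} :=
  (m \x @lebesgue_measure R)%E.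
pose isM := measure_function_pushforward__canonical__measure_function_Measure
  m' (@measurable_cons_rV n).
by exists isM; rewrite /= -mE.
Qed.

Let lebesgue_rV0 n : @lebesgue_rV n set0 = 0%E.
Proof. by case: (lebesgue_rV_measure n) => m <-; exact: measure0. Qed.

Let lebesgue_rV_ge0 n A : (0 <= @lebesgue_rV n A)%E.
Proof. by case: (lebesgue_rV_measure n) => m <-; exact: measure_ge0. Qed.

Let lebesgue_rV_sigma_additive n : semi_sigma_additive (@lebesgue_rV n).
Proof.
case: (lebesgue_rV_measure n) => m <-; exact: measure_semi_sigma_additive.
Qed.

HB.instance Definition _ n := isMeasure.Build _ _ _ (@lebesgue_rV n)
  (@lebesgue_rV0 n) (@lebesgue_rV_ge0 n) (@lebesgue_rV_sigma_additive n).

Definition box n (a b : 'rV[R]_n) : set 'rV[R]_n :=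
  [set x | forall i, a ord0 i <= x ord0 i <= b ord0 i].

Lemma measurable_box n (a b : 'rV[R]_n) : measurable (box a b).
Proof.
rewrite (_ : box a b = \bigcap_(i in [set: 'I_n])
    ((fun v : 'rV[R]_n => v ord0 i) @^-1` `[a ord0 i, b ord0 i])); last first.
  by apply/seteqP; split => [t H i _|t H i];
    [rewrite /= in_itv /=; exact: H|have := H i I; rewrite /= in_itv].
apply: fin_bigcap_measurable => // i _; rewrite -[X in measurable X]setTI.
exact: measurable_coord_rV.
Qed.

Lemma lebesgue_rV_box n (a b : 'rV[R]_n) :
  (forall i, a ord0 i <= b ord0 i) ->
  lebesgue_rV (box a b) = (\prod_i (b ord0 i - a ord0 i))%:E.
Proof.
elim: n a b => [|n IH] a b ab.
  by rewrite big_ord0 /= diracE mem_set// => -[].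
pose a' : 'rV_n := \row_i a ord0 (lift ord0 i).
pose b' : 'rV_n := \row_i b ord0 (lift ord0 i).
rewrite /= /pushforward (_ : _ @^-1` _ =
    box a' b' `*` `[a ord0 ord0, b ord0 ord0]%classic); last first.
  have c0 (z : 'rV[R]_n * measurableTypeR R) :
      cons_rV z ord0 ord0 = z.2.
    rewrite /cons_rV (_ : ord0 = lshift n (ord0 : 'I_1)); last exact/val_inj.
    by rewrite (row_mxEl (z.2)%:M) mxE eqxx.
  have cS (z : 'rV[R]_n * measurableTypeR R) i :
      cons_rV z ord0 (lift ord0 i) = z.1 ord0 i.
    rewrite /cons_rV (_ : lift ord0 i = rshift 1 i); last exact/val_inj.
    by rewrite (row_mxEr (z.2)%:M).
  apply/seteqP; split => [z zB|z [zB z0] i] /=.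
    split => [i|]; last by rewrite /= in_itv /= -c0; exact: zB.
    by rewrite !mxE -cS; exact: zB.
  case: (unliftP ord0 i) => [j|] ->; last first.
    by rewrite c0; move: z0; rewrite /= in_itv.
  by rewrite cS; have := zB j; rewrite !mxE.
rewrite product_measure1E//; last exact: measurable_box.
rewrite /= IH => [|i]; last by rewrite !mxE.
rewrite lebesgue_measure_itv /= lte_fin big_ord_recl.
rewrite [X in (X%:E * _)%E](eq_bigr
    (fun i => b ord0 (lift ord0 i) - a ord0 (lift ord0 i))); last first.
  by move=> i _; rewrite !mxE.
have := ab ord0; rewrite le_eqVlt => /predU1P[->|lt0].
  by rewrite ltxx subrr mul0r mule0.
by rewrite lt0 -EFinB -EFinM mulrC.
Qed.

End lebesgue_rV.

(* The topological support of mu, i.e. the complement of the largest mu-null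
   open set. *)
Definition measure_support (R : realType) (T : topologicalType)
    (mu : set T -> \bar R) : set T :=
  [set x | forall U, open U -> U x -> (0 < mu U)%E].

Section polynomials.
Context {R : realType}.

(* With this convention the zero polynomial has degree 0. *)
Definition mpoly_deg n (q : mpoly n R) : nat := (msize q).-1.

Definition is_sos n (q : mpoly n R) : Prop :=
  exists s : seq (mpoly n R), q = \sum_(r <- s) r ^+ 2.

Definition eval_rV n (q : mpoly n R) (x : 'rV[R]_n) : R :=
  meval (fun i => x ord0 i) q.

(* The first n variables of q are x, the last p ones are omega. *)
Definition eval_pair n p (q : mpoly (n + p) R) (z : 'rV[R]_n * 'rV[R]_p) : R :=
  eval_rV q (row_mx z.1 z.2).

Definition sq_norm_poly n : mpoly n R := \sum_(i < n) mpolyX R (mnm1 i) ^+ 2.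

End polynomials.

Section program.
Context {R : realType} {n p : nat}.
Variables (X : set 'rV[R]_n) (Omega : set 'rV[R]_p).
Variables (lambda : set 'rV[R]_n -> \bar R) (mu : set 'rV[R]_p -> \bar R).
Variable K : set ('rV[R]_n * 'rV[R]_p).

Definition feasible (d : nat) (q : mpoly (n + p) R) : Prop :=
  [/\ (mpoly_deg q <= 2 * d)%N, forall z, K z -> 1 <= eval_pair q z & is_sos q].

Definition objective (q : mpoly (n + p) R) : \bar R :=
  (\int[lambda \x mu]_(z in X `*` Omega) (eval_pair q z)%:E)%E.

Definition optimal (d : nat) (q : mpoly (n + p) R) : Prop :=
  feasible d q /\ forall r, feasible d r -> (objective q <= objective r)%E.

End program.

(* Main.v *)
Require Import Defs.
From HB Require Import structures.
From mathcomp Require Import all_boot all_order all_algebra.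
From mathcomp Require Import -(notations) mpoly.
From mathcomp Require Import all_classical all_reals all_analysis.
From mathcomp Require Import measurable_realfun ring lra.

Set Implicit Arguments.
Unset Strict Implicit.
Unset Printing Implicit Defensive.

Import Order.TTheory GRing.Theory Num.Theory.
Import numFieldNormedType.Exports.

Local Open Scope classical_set_scope.
Local Open Scope ring_scope.

(** Since [p_d^* >= 1] on [K] and [p_d^*] is a sum of squares, [h_d^*(x) >=
    mu (K_x)] on [X], so [X^*] is contained in every [X^d] and only the excess
    measure has to be controlled. By optimality the integral of [h_d^*] is
    eventually at most that of any fixed sum of squares [q >= 1] on [K], and
    such [q] exist whose integral is arbitrarily close to [(lambda x mu) K]:
    take the square of the product over [j] of [s_k ((1 - g_j / B) / 2)], where
    [B] bounds all [|g_j|] on [X x Omega] and the polynomials [s_k] tend on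
    [[0, 1]] to the indicator of [[0, 1/2]], stay bounded and are at least 1 on
    [[0, 1/2]]. Hence [h_d^*] tends to [mu (K_x)] in [L^1], and Markov's
    inequality together with continuity from above of
    [t |-> lambda {x | mu (K_x) >= t}] gives the convergence of the measures. *)

(** * Polynomial approximation of the indicator of [0, 1/2] on [0, 1] *)

Lemma bernoulli_ineq (R : realDomainType) (x : R) k :
  -1 <= x -> 1 + x *+ k <= (1 + x) ^+ k.
Proof.
move=> x1; elim: k => [|k IH]; first by rewrite mulr0n addr0 expr0.
have x10 : 0 <= 1 + x by lra.
rewrite exprS; apply: le_trans (ler_wpM2l x10 IH).
rewrite mulrS -mulr_natl; have : 0 <= k%:R * x ^+ 2 by rewrite mulr_ge0 ?sqr_ge0.
by rewrite expr2; nra.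
Qed.

Section soft_step.
Variable R : realType.

(* At [v = 1/2] Bernoulli gives [(1 - v^N)^(2^(j^2)) >= 1 - 2^-j] for
   [N = j^2 + j], whence the normalization; for [v > 1/2] the quantity
   [2^(j^2) v^N = ((2 v)^j v)^j] blows up. *)
Definition soft_step (j : nat) (v : R) : R :=
  (1 - v ^+ (j * j.+1)) ^+ (2 ^ (j * j)) / (1 - 2 ^- j).

Let denom_gt0 j : (0 < j)%N -> 2^-1 <= 1 - 2^- j :> R.
Proof.
move=> j0; suff : 2^-j <= 2^-1 :> R by lra.
rewrite lef_pV2 ?posrE ?exprn_gt0//.
by rewrite -[leLHS]expr1 ler_weXn2l// ler1n.
Qed.

(** The numerator lies in [0, 1] and, for [j > 0], the denominator is at least 1/2; at [j = 0] it
    vanishes. *)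
Lemma soft_step_ge0_le2 j v : (0 < j)%N -> 0 <= v <= 1 ->
  0 <= soft_step j v <= 2.
Proof.
move=> j0 /andP[v0 v1]; have dj := denom_gt0 j0.
have d0 : 0 < 1 - 2^-j :> R by lra.
have x0 : 0 <= v ^+ (j * j.+1) by rewrite exprn_ge0.
have x1 : v ^+ (j * j.+1) <= 1 by rewrite exprn_ile1.
have x1' : 0 <= 1 - v ^+ (j * j.+1) by rewrite subr_ge0.
rewrite /soft_step divr_ge0 ?exprn_ge0 ?(ltW d0)//=.
rewrite ler_pdivrMr//; apply: (@le_trans _ _ 1); last by lra.
by rewrite exprn_ile1 ?gerBl ?subr_ge0.
Qed.

Lemma soft_step_ge1 j v : (0 < j)%N -> 0 <= v <= 2^-1 ->
  1 <= soft_step j v <= (1 - 2^-j)^-1.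
Proof.
move=> j0 /andP[v0 v1]; have dj := denom_gt0 j0.
have d0 : 0 < 1 - 2^-j :> R by lra.
have x0 : 0 <= v ^+ (j * j.+1) by rewrite exprn_ge0.
have x1 : v ^+ (j * j.+1) <= 1 by rewrite exprn_ile1//; lra.
rewrite /soft_step ler_pdivlMr// mul1r; apply/andP; split; last first.
  rewrite -[leRHS]mul1r ler_wpM2r ?invr_ge0 ?(ltW d0)//.
  by rewrite exprn_ile1 ?gerBl ?subr_ge0.
(* Bernoulli reduces the claim to [2^(j^2) v^(j^2 + j) <= 2^-j]; the left side is [(2 v)^(j^2) v^j],
   with [2 v <= 1] and [v <= 1/2]. *)
have := @bernoulli_ineq _ (- v ^+ (j * j.+1)) (2 ^ (j * j)).
rewrite lerN2 => /(_ x1); apply: le_trans; rewrite lerD2l mulNrn lerN2.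
rewrite -[_ *+ (2 ^ _)]mulr_natl natrX mulnS [(j + _)%N]addnC exprD mulrA -exprMn.
rewrite -[leRHS]mul1r -exprVn ler_pM ?exprn_ge0 ?mulr_ge0//.
  by rewrite exprn_ile1 ?mulr_ge0//; lra.
by apply: lerXn2r; rewrite ?nnegrE//; lra.
Qed.

(** Put [x = v^(j^2 + j)] and [k = 2^(j^2)]. The hypothesis, true for large [j] when [v > 1/2],
    gives [k x = ((2 v)^j v)^j >= 2^j], hence [(1 + x)^k >= 2^j] by Bernoulli. As
    [(1 - x)^k (1 + x)^k = (1 - x^2)^k <= 1], the numerator is at most [2^-j]; the denominator costs
    a factor 2. *)
Lemma soft_step_le_pow j v : (0 < j)%N -> 0 < v <= 1 -> 2 <= (2 * v) ^+ j * v ->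
  soft_step j v <= 2 * 2^-1 ^+ j.
Proof.
move=> j0 /andP[v0 v1] v2; have dj := denom_gt0 j0.
have d0 : 0 < 1 - 2^-j :> R by lra.
set x := v ^+ (j * j.+1).
have x0 : 0 <= x by rewrite exprn_ge0// ltW.
have x1 : x <= 1 by rewrite exprn_ile1// ltW.
set k := (2 ^ (j * j))%N.
have kx : 2 ^+ j <= x *+ k.
  rewrite -[x *+ k]mulr_natl natrX /x mulnS [(j + _)%N]addnC exprD mulrA.
  rewrite -exprMn exprM.
  by rewrite -exprMn lerXn2r// nnegrE// (le_trans _ v2).
have x1k : (1 - x) ^+ k * 2 ^+ j <= 1.
  apply: (@le_trans _ _ ((1 - x) ^+ k * (1 + x) ^+ k)).
    apply: ler_wpM2l; first by rewrite exprn_ge0// subr_ge0.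
    apply: le_trans kx _; apply: le_trans (bernoulli_ineq _ _); last by lra.
    by rewrite lerDr.
  rewrite -exprMn exprn_ile1//.
    by rewrite mulr_ge0//; lra.
  by rewrite -subr_sqr expr1n gerBl sqr_ge0.
rewrite /soft_step -/x -/k ler_pdivrMr//.
rewrite exprVn -ler_pdivlMr ?exprn_gt0// mul1r in x1k *.
apply: (le_trans x1k).
by rewrite -mulrA mulrCA -[leLHS]mulr1 ler_wpM2l//; lra.
Qed.

Lemma cvg_soft_step v : 0 <= v <= 1 ->
  soft_step j v @[j --> \oo] --> ((v <= 2^-1)%R%:R : R).
Proof.
move=> v01.
have c2 : (2^-1 : R) ^+ j @[j --> \oo] --> (0 : R).
  by apply: cvg_expr; rewrite ger0_norm; lra.
have [vle|vgt] /= := leP v 2^-1.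
  apply: (@squeeze_cvgr _ _ _ _ (fun=> 1) (fun j => (1 - 2^-j)^-1)).
  - near=> j; apply: soft_step_ge1; first by near: j; exists 1%N.
    by move: v01 => /andP[-> _].
  - exact: cvg_cst.
  - rewrite -[X in _ --> X]invr1.
    apply: cvgV; first by rewrite oner_neq0.
    rewrite -[X in _ --> X](subr0 1); apply: cvgB; first exact: cvg_cst.
    by under eq_fun do rewrite -exprVn.
apply: (@squeeze_cvgr _ _ _ _ (fun=> 0) (fun j => 2 * 2^-1 ^+ j)).
- near=> j.
  have j0 : (0 < j)%N by near: j; exists 1%N.
  move: (v01) => /(soft_step_ge0_le2 j0)/andP[-> _] /=.
  move: v01 => /andP[v0 v1].
  apply: soft_step_le_pow => //; first by rewrite v1 andbT; lra.
  rewrite -ler_pdivrMr; last by lra.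
  have w0 : 0 < 2 * v - 1 by lra.
  (* Since [(2 v)^j >= 1 + j (2 v - 1)] by Bernoulli, this threshold forces [(2 v)^j >= 2 / v]. *)
  have : 2 / v / (2 * v - 1) <= j%:R by near: j; exact: nbhs_infty_ger.
  rewrite [X in is_true X -> _]ler_pdivrMr// [j%:R * _]mulr_natl => h; apply: (le_trans h).
  have := @bernoulli_ineq _ (2 * v - 1) j; rewrite [1 + (_ - 1)]addrC subrK.
  by move=> /(_ ltac:(lra)); apply: le_trans; rewrite lerDr.
- exact: cvg_cst.
- by rewrite -[X in _ --> X](mulr0 2); apply: cvgM => //; exact: cvg_cst.
Unshelve. all: by end_near. Qed.

End soft_step.

(** * Measurability and boundedness of polynomial functions *)

Section mpoly_eval.
Context {R : realType}.

Lemma measurable_eval_rV n (q : mpoly n R) : measurable_fun setT (eval_rV q).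
Proof.
rewrite (_ : eval_rV q = fun v => \sum_(s <- msupp q)
    mcoeff s q * \prod_(i < n) v ord0 i ^+ s i); last first.
  by apply/funext => v; rewrite /eval_rV mevalE.
apply: measurable_sum => s; apply: measurable_funM; first exact: measurable_cst.
apply: measurable_prod => i _; apply: measurable_funX.
exact: measurable_coord_rV.
Qed.

Lemma measurable_row_mx n p :
  measurable_fun setT (fun z : 'rV[R]_n * 'rV[R]_p => row_mx z.1 z.2).
Proof.
apply: measurable_fun_rV => i; case: (split_ordP i) => j ->.
  rewrite (_ : (fun=> _) = (fun v : 'rV[R]_n => v ord0 j) \o fst); last first.
    by apply/funext => z; rewrite row_mxEl.
  exact: measurableT_comp (measurable_coord_rV j) measurable_fst.
rewrite (_ : (fun=> _) = (fun v : 'rV[R]_p => v ord0 j) \o snd); last first.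
  by apply/funext => z; rewrite row_mxEr.
exact: measurableT_comp (measurable_coord_rV j) measurable_snd.
Qed.

Lemma measurable_eval_pair n p (q : mpoly (n + p) R) :
  measurable_fun setT (eval_pair q).
Proof.
rewrite (_ : eval_pair q = eval_rV q \o (fun z => row_mx z.1 z.2))//.
exact: measurableT_comp (measurable_eval_rV q) (@measurable_row_mx n p).
Qed.

Lemma eval_rV_bounded n (q : mpoly n R) (C : R) :
  exists B : R, forall v : 'rV[R]_n, (forall i, `|v ord0 i| <= C) -> `|eval_rV q v| <= B.
Proof.
exists (\sum_(s <- msupp q) `|mcoeff s q| * \prod_(i < n) C ^+ s i) => v vC.
rewrite /eval_rV mevalE (le_trans (ler_norm_sum _ _ _))// ler_sum// => s _.
rewrite normrM ler_wpM2l// normr_prod ler_prod// => i _.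
by rewrite normr_ge0 normrX lerXn2r// nnegrE// (le_trans _ (vC i)).
Qed.

Lemma compact_coord_bounded n (A : set 'rV[R]_n) :
  compact A -> exists C : R, forall (v : 'rV[R]_n) i, A v -> `|v ord0 i| <= C.
Proof.
move=> cA.
have bA i : exists C : R, forall v : 'rV[R]_n, A v -> `|v ord0 i| <= C.
  have : compact ((fun v : 'rV[R]_n => v ord0 i) @` A).
    apply: continuous_compact => //; apply: continuous_subspaceT.
    exact: coord_continuous.
  (* Every real strictly above [C] is a bound, hence [C + 1]. *)
  move=> /compact_bounded[C [_ CA]]; exists (C + 1) => v Av.
  by apply: (CA (C + 1)); [rewrite ltrDl|exists v].
have [C CA] := choice bA.
exists (\sum_i `|C i|) => v i Av; apply: (le_trans (CA i v Av)).
rewrite (bigD1 i)//= (le_trans (ler_norm _))// lerDl.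
exact: sumr_ge0.
Qed.

End mpoly_eval.

(** * Sigma-finiteness of Lebesgue measure; closed sets and supports *)

Section lebesgue_sigma_finite.
Context {R : realType}.

Lemma lebesgue_rV_box_lty n (a b : 'rV[R]_n) : (lebesgue_rV (box a b) < +oo)%E.
Proof.
have [ab|] := pselect (forall i, a ord0 i <= b ord0 i).
  by rewrite lebesgue_rV_box ?ltry.
move=> /existsNP[i ab]; rewrite (_ : box a b = set0) ?measure0//.
by apply/seteqP; split=> // x /(_ i)/andP[ax /(le_trans ax)].
Qed.

(** Exhaustion by the cubes [[-k, k]^n]. Tonelli's theorem is applied below to Lebesgue measure on
    all of [R^n], which is in general not finite. *)
Let lebesgue_rV_sigma_finite n : sigma_finite setT (@lebesgue_rV R n).
Proof.
exists (fun k => box (const_mx (- k%:R)) (const_mx k%:R)).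
  apply/esym/seteqP; split=> // x _.
  have [C xC] := compact_coord_bounded (@compact_set1 _ x).
  exists (Num.truncn C).+1 => // i; rewrite !mxE -ler_norml.
  by rewrite (le_trans (xC x i erefl))// ltW// Num.Theory.truncnS_gt.
by move=> k; split; [exact: measurable_box|exact: lebesgue_rV_box_lty].
Qed.

HB.instance Definition _ n :=
  Measure_isSigmaFinite.Build _ _ _ (@lebesgue_rV R n) (@lebesgue_rV_sigma_finite n).

End lebesgue_sigma_finite.

(** A point outside the support has an open neighbourhood of measure zero, and that neighbourhood
    also witnesses that its other points lie outside. *)
Lemma closed_measure_support (R : realType) (T : topologicalType)
  (mu : set T -> \bar R) : closed (measure_support mu).
Proof.
rewrite -openC openE => x /existsNP[U] /not_implyP[oU] /not_implyP[Ux mU].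
rewrite /interior nbhsE; exists U; first by split.
by move=> y Uy /(_ U oU Uy).
Qed.

Lemma closed_measurable_rV (R : realType) n (A : set 'rV[R]_n) :
  closed A -> measurable A.
Proof.
move=> cA; rewrite -[A]setCK; apply: measurableC; apply: sub_sigma_algebra.
exact: closed_openC.
Qed.

(** * Sums of squares converging to the indicator of [K] *)

Section competitor.
Context {R : realType} {n p m : nat}.
Variable g : 'I_m.+1 -> mpoly (n + p) R.

(** A decreasing affine rescaling: for [B > 0], values of [g k] in [[-B, B]] go to [0, 1], the
    nonnegative ones to [0, 1/2]. *)
Definition rescaled_mpoly (B : R) (k : 'I_m.+1) : mpoly (n + p) R :=
  mpolyC (n + p) 2^-1 - (2^-1 / B) *: g k.

Definition soft_step_mpoly N (j : nat) (u : mpoly N R) : mpoly N R :=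
  (1 - u ^+ (j * j.+1)) ^+ (2 ^ (j * j)) * mpolyC N (1 - 2^-j)^-1.

(** The square yields a sum of squares while preserving both the lower bound 1 on [K] and the limits
    0 and 1. *)
Definition competitor (B : R) (j : nat) : mpoly (n + p) R :=
  (\prod_k soft_step_mpoly j (rescaled_mpoly B k)) ^+ 2.

Lemma competitor_sos B j : is_sos (competitor B j).
Proof.
exists [:: \prod_k soft_step_mpoly j (rescaled_mpoly B k)].
by rewrite big_seq1.
Qed.

Lemma eval_soft_step_mpoly N j (u : mpoly N R) v :
  eval_rV (soft_step_mpoly j u) v = soft_step j (eval_rV u v).
Proof.
by rewrite /eval_rV /soft_step_mpoly mevalM rmorphXn /= mevalB meval1 rmorphXn /= mevalC.
Qed.

Lemma eval_rescaled_mpoly B k z : 0 < B ->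
  eval_pair (rescaled_mpoly B k) z = (1 - eval_pair (g k) z / B) / 2.
Proof.
move=> B0; rewrite /eval_pair /eval_rV /rescaled_mpoly mevalB mevalC mevalZ.
by field; rewrite gt_eqF.
Qed.

Lemma eval_competitor B j z : 0 < B -> eval_pair (competitor B j) z =
  (\prod_k soft_step j ((1 - eval_pair (g k) z / B) / 2)) ^+ 2.
Proof.
move=> B0; rewrite /eval_pair /eval_rV /competitor rmorphXn rmorph_prod /=.
congr (_ ^+ 2); apply: eq_bigr => k _.
rewrite -[LHS]/(eval_rV _ _) eval_soft_step_mpoly; congr soft_step.
exact: eval_rescaled_mpoly.
Qed.

Let K := [set z | forall k, 0 <= eval_pair (g k) z].

Lemma rescaled_itv B (y : R) : `|y| <= B -> 0 < B -> 0 <= (1 - y / B) / 2 <= 1.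
Proof.
rewrite ler_norml => /andP[y1 y2] B0.
have : -1 <= y / B by rewrite ler_pdivlMr// mulN1r.
have : y / B <= 1 by rewrite ler_pdivrMr// mul1r.
by move=> ? ?; apply/andP; split; lra.
Qed.

Lemma rescaled_le_half B (y : R) : 0 < B ->
  ((1 - y / B) / 2 <= 2^-1) = (0 <= y).
Proof.
move=> B0; rewrite -[in RHS](@pmulr_lge0 _ B^-1) ?invr_gt0//.
by apply/idP/idP => ?; lra.
Qed.

(** Each of the [m + 1] factors is at most 2. The bound is independent of [j], so it can dominate
    the whole sequence. *)
Lemma competitor_bounded B j z : (0 < j)%N -> 0 < B ->
  (forall k, `|eval_pair (g k) z| <= B) ->
  0 <= eval_pair (competitor B j) z <= (2 ^+ m.+1) ^+ 2.
Proof.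
move=> j0 B0 gB; rewrite eval_competitor// sqr_ge0/=.
have s02 k := soft_step_ge0_le2 j0 (rescaled_itv (gB k) B0).
rewrite lerXn2r ?nnegrE//; first by apply: prodr_ge0 => k _; case/andP: (s02 k).
rewrite -[X in _ ^+ X]card_ord -prodr_const; apply: ler_prod => k _.
exact: s02.
Qed.

Lemma competitor_ge1 B j z : (0 < j)%N -> 0 < B ->
  (forall k, `|eval_pair (g k) z| <= B) -> K z ->
  1 <= eval_pair (competitor B j) z.
Proof.
move=> j0 B0 gB Kz; rewrite eval_competitor// exprn_ege1//.
have {1}<- : \prod_(k < m.+1) (1 : R) = 1 by rewrite big1.
apply: ler_prod => k _; rewrite ler01/=.
have /andP[v0 _] := rescaled_itv (gB k) B0.
suff : 1 <= soft_step j ((1 - eval_pair (g k) z / B) / 2) <= (1 - 2^-j)^-1.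
  by case/andP.
by apply: soft_step_ge1; rewrite // v0 rescaled_le_half//; exact: Kz.
Qed.

Lemma cvg_competitor B z : 0 < B -> (forall k, `|eval_pair (g k) z| <= B) ->
  eval_pair (competitor B j) z @[j --> \oo] --> (\1_K z : R).
Proof.
move=> B0 gB; under eq_fun do rewrite eval_competitor//.
(* The indicator of [K] is brought to the shape of the competitor, so that the limit can be taken
   factor by factor. *)
have -> : \1_K z = (\prod_k ((0 <= eval_pair (g k) z)%R%:R : R)) ^+ 2.
  rewrite indicE; have [Kz|/negP nKz] := boolP (z \in K).
    by rewrite big1 ?expr1n// => k _; rewrite inE in Kz; rewrite Kz.
  have /existsNP[k nk] : ~ (K z) by move=> Kz; apply: nKz; rewrite inE.
  rewrite (bigD1 k)//= (_ : (0 <= _)%R = false); last exact/negP.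
  by rewrite mul0r expr0n.
apply: (@cvg_comp _ _ _ _ (fun x : R => x ^+ 2)); last exact: exprn_continuous.
apply: cvg_big => [|k _]; first exact: mul_continuous.
by rewrite -(rescaled_le_half _ B0); exact: cvg_soft_step (rescaled_itv _ _).
Qed.

End competitor.

(** * Superlevel sets under one-sided convergence in [L^1] *)

Section superlevel.
Context d (T : measurableType d) (R : realType).
Variable nu : {measure set T -> \bar R}.
Local Open Scope ereal_scope.

(** Markov's inequality for [f - h], written without subtraction: integrate [h + t 1_E <= f] over
    [X], then cancel the integral of [h], which is finite. *)
Lemma superlevel_gap_le (X : set T) (h f : T -> R) (t D : R) :
  measurable X -> measurable_fun setT h -> measurable_fun setT f -> (0 < t)%R ->
  (forall x, X x -> 0 <= h x <= f x)%R ->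
  \int[nu]_(x in X) (h x)%:E < +oo ->
  \int[nu]_(x in X) (f x)%:E <= \int[nu]_(x in X) (h x)%:E + D%:E ->
  nu (X `&` [set x | h x + t <= f x]%R) <= (D / t)%:E.
Proof.
move=> mX mh mf t0 hf ih fD; set E := [set x | _].
have mE : measurable E.
  rewrite -[E]setTI; apply: measurable_fun_le => //.
  by apply: measurable_funD.
have h0 x : X x -> (0 <= h x)%R by move=> /hf/andP[].
have mXh : measurable_fun X (fun x => (h x)%:E).
  by apply/measurable_EFinP; exact: measurable_funS mh.
have mXf : measurable_fun X (fun x => (f x)%:E).
  by apply/measurable_EFinP; exact: measurable_funS mf.
have m1E : measurable_fun X (fun x => (t * \1_E x)%:E).
  apply/measurable_EFinP.
  apply: measurable_funM; first exact: measurable_cst.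
  exact: measurable_indic.
have tE : \int[nu]_(x in X) (t * \1_E x)%:E = t%:E * nu (X `&` E).
  under eq_integral do rewrite EFinM.
  rewrite ge0_integralZl//; last by rewrite lee_fin ltW.
    by rewrite integral_indic// setIC.
  by apply/measurable_EFinP; exact: measurable_indic.
have ih0 : 0 <= \int[nu]_(x in X) (h x)%:E by apply: integral_ge0 => x /h0.
have fin_h : \int[nu]_(x in X) (h x)%:E \is a fin_num by rewrite ge0_fin_numE.
have : \int[nu]_(x in X) (h x)%:E + t%:E * nu (X `&` E) <=
    \int[nu]_(x in X) (h x)%:E + D%:E.
  apply: le_trans fD; rewrite -tE -ge0_integralD//; last first.
    by move=> x _; rewrite lee_fin mulr_ge0// ltW.
  apply: ge0_le_integral => //.
  - by move=> x Xx; rewrite -EFinD lee_fin addr_ge0 ?h0// mulr_ge0// ltW.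
  - exact: emeasurable_funD.
  - move=> x Xx; rewrite -EFinD lee_fin indicE.
    have [|_] := boolP (x \in E); first by rewrite inE mulr1.
    by rewrite mulr0 addr0; case/andP: (hf x Xx).
rewrite leeD2lE// => tED.
by rewrite EFinM lee_pdivlMr// muleC.
Qed.

(** The sets for [f k] eventually contain the one for [h]. Their excess lies where [h] is just below
    [c] or where [f k] exceeds [h] by a fixed gap; each part is made at most [e / 2]. *)
Lemma cvg_superlevel (X : set T) (h : T -> R) (f : nat -> T -> R) (c : R) :
  measurable X -> nu X < +oo ->
  measurable_fun setT h -> (forall k, measurable_fun setT (f k)) ->
  (\forall k \near \oo, forall x, X x -> 0 <= h x <= f k x)%R ->
  \int[nu]_(x in X) (h x)%:E < +oo ->
  (forall e : R, (0 < e)%R -> \forall k \near \oo,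
    \int[nu]_(x in X) (f k x)%:E <= \int[nu]_(x in X) (h x)%:E + e%:E) ->
  nu [set x | X x /\ (c <= f k x)%R] @[k --> \oo] -->
  nu [set x | X x /\ (c <= h x)%R].
Proof.
move=> mX nuX mh mf hf ih iF.
have msup (u : T -> R) s : measurable_fun setT u ->
    measurable [set x | X x /\ (s <= u x)%R].
  move=> mu; apply: measurableI => //.
  rewrite -[X in measurable X]setTI.
  exact: measurable_fun_le.
have sup_lty (u : T -> R) s : measurable_fun setT u ->
    nu [set x | X x /\ (s <= u x)%R] < +oo.
  move=> mu; apply: le_lt_trans nuX.
  by apply: le_measure => [||x []//]; rewrite ?inE//; exact: msup.
(* These sets decrease to the superlevel set of [h]; continuity from above applies because [nu X] is
   finite. *)
pose S k := [set x | X x /\ (c - k.+1%:R^-1 <= h x)%R].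
have SE : \bigcap_k S k = [set x | X x /\ (c <= h x)%R].
  apply/seteqP; split=> x /=; last first.
    by move=> [Xx cx] k _; split=> //; rewrite lerBlDr (le_trans cx)// lerDl.
  move=> Sx; split; first by have [] := Sx 0%N I.
  apply/ler_addgt0Pr => e e0.
  have [k ke] : exists k, (k.+1%:R^-1 < e)%R.
    by exists (Num.truncn e^-1); rewrite invf_plt ?posrE// truncnS_gt.
  have [_] := Sx k I; rewrite lerBlDr => /le_trans; apply.
  by rewrite lerD2l ltW.
have cS : nu (S k) @[k --> \oo] --> nu [set x | X x /\ (c <= h x)%R].
  rewrite -SE; apply: nonincreasing_cvg_mu.
  - exact: sup_lty.
  - by move=> k; exact: msup.
  - by rewrite SE; exact: msup.
  - move=> k l kl; apply/subsetPset => x [Xx cx]; split => //.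
    by apply: le_trans cx; rewrite lerB// lef_pV2 ?posrE// ler_nat.
have finh : nu [set x | X x /\ (c <= h x)%R] \is a fin_num.
  by rewrite ge0_fin_numE// sup_lty.
rewrite -[X in _ --> X](fineK finh); apply/fine_cvgP; split.
  by near=> k; rewrite ge0_fin_numE//; exact: sup_lty.
apply/cvgrPdist_le => e e0.
have [s Ss] : exists s, nu (S s) <= (fine (nu [set x | X x /\ (c <= h x)%R]) + e / 2)%:E.
  move: cS; rewrite -[X in _ --> X](fineK finh) => /fine_cvgP[_].
  have e20 : (0 < e / 2)%R by rewrite divr_gt0.
  move=> /cvgrPdist_le/(_ _ e20)[s _ /(_ s (leqnn s))] /=.
  rewrite ler_distlC => /andP[_ le_s]; exists s.
  rewrite -lee_fin fineK ?ge0_fin_numE// in le_s; exact: sup_lty.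
pose t : R := (s.+1%:R^-1)%R.
have t0 : (0 < t)%R by rewrite invr_gt0.
(* With this tolerance on the integrals, the Markov bound [D / t] equals [e / 2]. *)
have De : (0 < t * (e / 2))%R by rewrite mulr_gt0// divr_gt0.
near=> k.
have hfk : forall x, X x -> (0 <= h x <= f k x)%R by near: k.
have ifk : \int[nu]_(x in X) (f k x)%:E <=
    \int[nu]_(x in X) (h x)%:E + (t * (e / 2))%:E by near: k; exact: iF.
have Ak_fin : nu [set x | X x /\ (c <= f k x)%R] \is a fin_num.
  by rewrite ge0_fin_numE// sup_lty.
have gap := superlevel_gap_le mX mh (mf k) t0 hfk ih ifk.
have mgap : measurable (X `&` [set x | h x + t <= f k x]%R).
  by apply: measurable_fun_le => //; [apply: measurable_funD => //|];
    apply: measurable_funTS.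
rewrite ler_distlC -2!lee_fin EFinB !fineK//; apply/andP; split.
  rewrite leeBlDr// -[leLHS]adde0 leeD ?lee_fin ?(ltW e0)//.
  apply: le_measure; rewrite ?inE; [exact: msup|exact: msup|].
  by move=> x [Xx cx]; split=> //; case/andP: (hfk x Xx) => _; exact: le_trans.
(* If [f k x < h x + t], then [c <= f k x] forces [h x >= c - t]. *)
have sub : [set x | X x /\ (c <= f k x)%R] `<=`
    S s `|` (X `&` [set x | h x + t <= f k x]%R).
  move=> x [Xx cx]; have [htx|ltx] := leP (h x + t)%R (f k x).
    by right.
  left; split => //; rewrite lerBlDr; exact: le_trans cx (ltW ltx).
have mS : measurable (S s) by exact: msup.
apply: (@le_trans _ _ (nu (S s `|` (X `&` [set x | h x + t <= f k x]%R)))).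
  by apply: le_measure; rewrite ?inE//; [exact: msup|exact: measurableU].
apply: le_trans (measureU2 _ mS mgap) _.
apply: le_trans (leeD Ss gap) _.
rewrite -EFinD lee_fin mulrAC divff ?gt_eqF// mul1r.
by rewrite -addrA -splitr.
Unshelve. all: by end_near. Qed.

End superlevel.

(** Tonelli on the whole product for [f] extended by 0 off the rectangle; the inner integral
    vanishes for [x] outside [A]. *)
Lemma integral_setX_fubini d1 d2 (T1 : measurableType d1)
  (T2 : measurableType d2) (R : realType)
  (m1 : {sigma_finite_measure set T1 -> \bar R})
  (m2 : {sigma_finite_measure set T2 -> \bar R})
  (A : set T1) (B : set T2) (f : T1 * T2 -> \bar R) :
  measurable A -> measurable B -> measurable_fun setT f ->
  (forall z, 0 <= f z)%E ->
  (\int[m1 \x m2]_(z in A `*` B) f z =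
   \int[m1]_(x in A) \int[m2]_(y in B) f (x, y))%E.
Proof.
move=> mA mB mf f0.
rewrite integral_mkcond fubini_tonelli1.
- rewrite [RHS]integral_mkcond; apply: eq_integral => x _ /=.
  rewrite /fubini_F patchE; case: ifPn => xA.
    rewrite [RHS]integral_mkcond; apply: eq_integral => y _.
    by rewrite !patchE in_setX xA.
  by apply: integral0_eq => y _; rewrite patchE in_setX (negbTE xA).
- apply/(measurable_restrictT _ _).1 => //; first exact: measurableX.
  exact: measurable_funTS.
- by move=> z; rewrite patchE; case: ifPn.
Qed.

Lemma sos_ge0 (R : realType) n (q : mpoly n R) v : is_sos q -> 0 <= eval_rV q v.
Proof.
move=> [s ->]; rewrite /eval_rV raddf_sum /= sumr_ge0// => r _.
by rewrite rmorphXn sqr_ge0.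
Qed.

(** * Asymptotics of the optimal solutions *)

Section superlevel_approximation.
Context {R : realType} {n p m : nat}.
Variables (lam : {sigma_finite_measure set 'rV[R]_n -> \bar R}).
Variables (mu : probability 'rV[R]_p R).
Variables (X : set 'rV[R]_n) (Omega : set 'rV[R]_p).
Variable g : 'I_m.+1 -> mpoly (n + p) R.
Let K := [set z | forall k, 0 <= eval_pair (g k) z].
Hypotheses (mX : measurable X) (mOmega : measurable Omega).
Hypotheses (lamX : (lam X < +oo)%E) (KXO : K `<=` X `*` Omega).
Hypothesis bddX :
  exists C : R, forall (x : 'rV[R]_n) i, X x -> `|x ord0 i| <= C.
Hypothesis bddOmega :
  exists C : R, forall (w : 'rV[R]_p) i, Omega w -> `|w ord0 i| <= C.

Lemma measurable_basic_closed : measurable K.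
Proof.
rewrite (_ : K = \bigcap_(k in [set: 'I_m.+1])
    (setT `&` [set z | 0 <= eval_pair (g k) z])).
  apply: fin_bigcap_measurable => // k _; apply: measurable_fun_le => //.
  exact: measurable_eval_pair.
apply/seteqP; split=> [z Kz k _|z Kz k]; first by split=> //; exact: Kz.
by have [] := Kz k I.
Qed.

Let product_lty : ((lam \x mu) (X `*` Omega) < +oo)%E.
Proof.
rewrite product_measure1E// lte_mul_pinfty ?measure_ge0//.
  by rewrite ge0_fin_numE.
by rewrite (le_lt_trans (probability_le1 _ _))// ltry.
Qed.

Let constraint_bound : exists2 B : R, 0 < B &
  forall z k, (X `*` Omega) z -> `|eval_pair (g k) z| <= B.
Proof.
have [C1 XC] := bddX; have [C2 OC] := bddOmega.
have /choice[B gB] k := eval_rV_bounded (g k) (Num.max C1 C2).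
(* The sum serves all constraints at once; the summand 1 makes the bound positive, as the rescaling
   requires. *)
exists (1 + \sum_k `|B k|); first by rewrite ltr_pwDl// sumr_ge0.
move=> z k [Xz Oz]; apply: (@le_trans _ _ (B k)).
  apply: gB => i; rewrite le_max.
  case: (split_ordP i) => j ->; rewrite ?row_mxEl ?row_mxEr ?XC ?OC ?orbT//.
rewrite (le_trans (ler_norm _))// (bigD1 k)//= addrCA lerDl.
by rewrite addr_ge0 ?sumr_ge0.
Qed.

Let P := X `*` Omega.
Let mP : measurable P. Proof. exact: measurableX. Qed.

(** Dominated convergence on [X * Omega], whose measure is finite, with a constant as dominating
    function. The degrees of the [q j] are left free: each one is feasible once [d] is large. *)
Lemma cvg_integral_competitor : exists q : nat -> mpoly (n + p) R,
  [/\ forall j, is_sos (q j),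
      forall j z, K z -> 1 <= eval_pair (q j) z &
      objective X Omega lam mu (q j) @[j --> \oo] --> (lam \x mu)%E K].
Proof.
have [B B0 gB] := constraint_bound.
have mK := measurable_basic_closed.
(* The index is shifted because the bounds on [soft_step] require a positive one. *)
exists (fun j => competitor g B j.+1); split => [j|j z Kz|].
- exact: competitor_sos.
- by apply: competitor_ge1 => // k; exact: gB (KXO Kz).
have -> : (lam \x mu)%E K = (\int[lam \x mu]_(z in P) (\1_K z)%:E)%E.
  by rewrite integral_indic// setIidl.
have [|||||_ _] := @dominated_convergence _ _ _ (lam \x mu)%E P mP
  (fun j z => (eval_pair (competitor g B j.+1) z)%:E)
  (fun z => (\1_K z)%:E) (cst ((2 ^+ m.+1) ^+ 2)%:E).
- move=> j; apply/measurable_EFinP/measurable_funTS.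
  exact: measurable_eval_pair.
- by apply/measurable_EFinP; exact: measurable_indic.
- apply: aeW => z Pz; apply: cvg_EFin; first exact: nearW.
  rewrite (cvg_shiftS (fun j => eval_pair (competitor g B j) z)).
  by apply: cvg_competitor => // k; exact: gB.
- apply/integrableP; split; first exact: measurable_cst.
  under eq_integral => z _ do rewrite /= ger0_norm ?sqr_ge0//.
  by rewrite integral_cst// lte_mul_pinfty.
- apply: aeW => z j Pz /=; have /andP[q0 q1] :=
    competitor_bounded (ltn0Sn j) B0 (fun k => gB z k Pz).
  by rewrite lee_fin ger0_norm.
- by [].
Qed.

Let h x := fine (mu (xsection K x)).

Let hE x : (h x)%:E = mu (xsection K x).
Proof.
rewrite fineK// fin_num_measure//.
exact: measurable_xsection measurable_basic_closed.
Qed.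

Let mh : measurable_fun setT h.
Proof.
apply: measurableT_comp => //.
exact: measurable_fun_xsection measurable_basic_closed.
Qed.

(** The product measure unfolds to the integral of the section measures over the whole space, and
    sections over points outside [X] are empty. *)
Let integral_h : (\int[lam]_(x in X) (h x)%:E = (lam \x mu) K)%E.
Proof.
rewrite integral_mkcond; apply: eq_integral => x _ /=.
rewrite patchE; case: ifPn => [_|xX]; first exact: hE.
rewrite (_ : xsection K x = set0) ?measure0//.
apply/seteqP; split=> // w; rewrite /xsection /= inE => /KXO[/= Xx _].
by move: xX; rewrite notin_setE.
Qed.

Lemma cvg_superlevel_optimal (d0 : nat) (pstar : nat -> mpoly (n + p) R)
    (hstar : nat -> mpoly n R) (c : R) :
  (forall d, (d0 <= d)%N -> optimal X Omega lam mu K d (pstar d)) ->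
  (forall d, (d0 <= d)%N -> forall x, (eval_rV (hstar d) x)%:E =
      (\int[mu]_(w in Omega) (eval_pair (pstar d) (x, w))%:E)%E) ->
  lam [set x | X x /\ c <= eval_rV (hstar d) x] @[d --> \oo] -->
  lam [set x | X x /\ (c%:E <= mu (xsection K x))%E].
Proof.
move=> opt hstarE; have mK := measurable_basic_closed.
rewrite (_ : [set x | _ /\ (_ <= _)%E] = [set x | X x /\ c <= h x]); last first.
  by apply/seteqP; split=> x /=; rewrite -hE lee_fin.
have K_lty : ((lam \x mu) K < +oo)%E.
  by apply: le_lt_trans product_lty; apply: le_measure; rewrite ?inE.
apply: cvg_superlevel => //.
- by move=> d; exact: measurable_eval_rV.
- near=> d => x Xx; have dd0 : (d0 <= d)%N by near: d; exists d0.
  rewrite fine_ge0//= -lee_fin hE hstarE//.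
  have [[_ pK psos] _] := opt d dd0.
  have mxK := measurable_xsection x mK.
  have -> : mu (xsection K x) =
      (\int[mu]_(w in Omega) (\1_(xsection K x) w)%:E)%E.
    rewrite integral_indic// setIidl// => w.
    by rewrite /xsection /= inE => /KXO[].
  apply: ge0_le_integral => //.
  + by apply/measurable_EFinP; exact: measurable_indic.
  + apply/measurable_EFinP/measurable_funTS.
    exact: measurableT_comp (measurable_eval_pair _) (measurable_pair1 _).
  (* On the section [pstar d >= 1] by feasibility; off it a sum of squares is still nonnegative. *)
  + move=> w _; rewrite lee_fin indicE.
    have [|_] := boolP (w \in _); last exact: sos_ge0.
    by rewrite inE /xsection/= inE => Kw; exact: pK.
- by rewrite integral_h.
- move=> e e0; have [q [qsos q1 cq]] := cvg_integral_competitor.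
  have [j qj] : exists j,
      (objective X Omega lam mu (q j) <= (lam \x mu) K + e%:E)%E.
    have Kfin : (lam \x mu)%E K \is a fin_num by rewrite ge0_fin_numE.
    move: cq; rewrite -(fineK Kfin) => /fine_cvgP[[N1 _ fq]].
    move=> /cvgrPdist_le/(_ _ e0)[N2 _ ge]; exists (maxn N1 N2).
    have := ge _ (leq_maxr N1 N2); rewrite /= ler_distlC => /andP[_].
    by rewrite -lee_fin fineK//; exact: fq (leq_maxl _ _).
  near=> d; have dd0 : (d0 <= d)%N by near: d; exists d0.
  rewrite integral_h; apply: le_trans qj.
  have [[_ _ psos] pmin] := opt d dd0.
  (* Any [d] at least the degree of [q j] will do, since [d <= 2 d]. *)
  have fq : feasible K d (q j).
    split; [|exact: q1|exact: qsos]; apply: (@leq_trans d); last by rewrite mul2n -addnn leq_addr.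
    by near: d; exists (mpoly_deg (q j)).
  (* By Tonelli the integral of [hstar d] over [X] is exactly the objective value of [pstar d]. *)
  apply: le_trans (pmin _ fq); rewrite le_eqVlt; apply/orP; left; apply/eqP.
  rewrite /objective integral_setX_fubini//.
  + by apply: eq_integral => x _; exact: hstarE.
  + by apply/measurable_EFinP; exact: measurable_eval_pair.
  + by move=> z; rewrite lee_fin; exact: sos_ge0.
Unshelve. all: by end_near. Qed.

End superlevel_approximation.

(** * Specialization to a box and the support of [mu] *)

Theorem mainTheorem4 (R : realType) (n p m : nat)
    (a b : 'rV[R]_n) (mu : probability 'rV[R]_p R)
    (M : R) (g : 'I_m.+1 -> mpoly (n + p) R) (eps : R)
    (pstar : nat -> mpoly (n + p) R) (hstar : nat -> mpoly n R) :
  let lambda : set 'rV[R]_n -> \bar R := @lebesgue_rV R n in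
  let X : set 'rV[R]_n := box a b in
  let Omega : set 'rV[R]_p := measure_support mu in
  let K : set ('rV[R]_n * 'rV[R]_p) :=
    [set z | forall j, 0 <= eval_pair (g j) z] in
  let K_ (x : 'rV[R]_n) : set 'rV[R]_p := [set w | Omega w /\ K (x, w)] in
  let d0 : nat := (\max_(j < m.+1) uphalf (mpoly_deg (g j)))%N in
  let Xstar : set 'rV[R]_n := [set x | X x /\ ((1 - eps)%:E <= mu (K_ x))%E] in
  let X_ (d : nat) : set 'rV[R]_n :=
    [set x | X x /\ 1 - eps <= eval_rV (hstar d) x] in
  0 < eps < 1 ->
  compact Omega ->
  0 < M ->
  g ord0 = mpolyC (n + p) M - sq_norm_poly (n + p) ->
  K `<=` X `*` Omega ->
  compact K ->
  K° !=set0 ->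
  ((X `*` Omega) `\` K)° !=set0 ->
  (forall d, (d0 <= d)%N -> optimal X Omega lambda mu K d (pstar d)) ->
  (forall d, (d0 <= d)%N ->
    (mpoly_deg (hstar d) <= 2 * d)%N /\
    forall x, (eval_rV (hstar d) x)%:E =
      (\int[mu]_(w in Omega) (eval_pair (pstar d) (x, w))%:E)%E) ->
  lambda (X_ d) @[d --> \oo] --> lambda Xstar.
Proof.
move=> lambda X Omega K K_ d0 Xstar X_ _ cOmega _ _ KXO _ _ _ opt hE.
(* As [K] lies in [X * Omega], intersecting a section with [Omega] leaves it unchanged. *)
have XstarE : Xstar = [set x | X x /\ ((1 - eps)%:E <= mu (xsection K x))%E].
  rewrite /Xstar; apply/funext => x.
  congr (_ /\ (_ <= mu _)%E).
  apply/seteqP; split=> w; rewrite /xsection /= inE; first by case.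
  by move=> Kw; split=> //; case: (KXO _ Kw).
rewrite XstarE.
apply: (@cvg_superlevel_optimal R n p m _ mu X Omega g
  _ _ _ KXO _ _ d0 _ _ _ opt).
- exact: measurable_box.
- by apply: closed_measurable_rV; exact: closed_measure_support.
- exact: lebesgue_rV_box_lty.
- exists (\sum_i (`|a ord0 i| + `|b ord0 i|)) => x i /(_ i)/andP[ax xb].
  rewrite (bigD1 i)//=; apply: (@le_trans _ _ (`|a ord0 i| + `|b ord0 i|)).
    rewrite ler_norml; apply/andP; split.
      apply: le_trans ax; rewrite lerNl (le_trans (ler_norm _))// normrN.
      by rewrite lerDl.
    by apply: (le_trans xb); rewrite (le_trans (ler_norm _))// lerDr.
  by rewrite lerDl sumr_ge0// => k _; rewrite addr_ge0.
- exact: compact_coord_bounded.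
- by move=> d /hE[].
Qed.
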